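(* Consider an inhomogeneous Galton-Watson tree with offspring distributions $(f_n)_{n\ge 0}$ on the non-negative integers, where $f_n$ has mean $\mu_n$ and variance $\sigma_n^2$. Let $Z_n$ be the number of vertices in generation $n$, let $Z$ be the total number of vertices in the tree, and write $m_n=\mathbb{E}(Z_n)$, $s_n^2=\operatorname{Var}(Z_n)$, $c_{n,n+k}=\operatorname{Cov}(Z_n,Z_{n+k})$, $m=\mathbb{E}(Z)$ and $s^2=\operatorname{Var}(Z)$. Then the first and second moments of $Z_n$ for $n\ge 0$ are given by $$m_n=\prod_{i=0}^{n-1}\mu_i,$$ $$s_n^2=\sum_{i=0}^{n-1}\sigma_i^2\left(\prod_{j=0}^{i-1}\mu_j\right)\left(\prod_{j=i+1}^{n-1}\mu_j^2\right),$$ $$c_{n,n+k}=s_n^2\,\frac{m_{n+k}}{m_n}\qquad\text{for }k>0.$$ Furthermore, the first and second moments of $Z$ are given by $$m=\sum_{n=0}^\infty\prod_{i=0}^{n-1}\mu_i,$$ $$s^2=\sum_{n=1}^\infty\left(s_n^2+2\,\frac{s_n^2}{m_n}\sum_{k=1}^\infty m_{n+k}\right).$$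
   Context: Inhomogeneous Galton-Watson tree: generation $0$ consists of one vertex. For $n=0,1,\ldots$, each vertex $i$ in generation $n$ has $X_{n,i}$ offspring (vertices of generation $n+1$), where $X_{n,i}$ is drawn from the distribution with probability function $f_n$ on $\{0,1,2,\ldots\}$, independently of everything else. The construction ends when there are no new offspring in a generation, and the output is the obtained directed tree. In general $Z$ may be infinite with positive probability. Convention: a sum over an empty index set is $0$ and a product over an empty index set is $1$ (so $m_0=1$, $s_0^2=0$, and $c_{0,k}=0$ for $k>0$).
   Formalization: The formula for s^2 is asserted only if m is finite or some sigma_i is nonzero, excluding deterministic infinite trees, where Var(Z) is undefined; Var(Z) is taken as infinite when m is infinite, and quotients by m_n = 0 (where s_n^2 = 0) are read as 0. *)

(* Defs.v *)
From HB Require Import structures.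
From mathcomp Require Import all_boot all_order all_algebra finmap.
From mathcomp Require Import all_classical all_reals all_analysis.

Set Implicit Arguments.
Unset Strict Implicit.
Unset Printing Implicit Defensive.

Import Order.TTheory GRing.Theory Num.Theory.
Import numFieldNormedType.Exports.

Local Open Scope classical_set_scope.
Local Open Scope ring_scope.

(* Vertices are Ulam-Harris words: the root is [::] and the children of v are
   rcons v 0, rcons v 1, ...  A generation is the list of its vertices, so that
   the numbers x n i (i < size (generation x n)) are the ones that are used. *)
Fixpoint generation (x : nat -> nat -> nat) (n : nat) : seq (seq nat) :=
  if n is n'.+1 then
    let g := generation x n' in
    [seq rcons (nth [::] g i) j | i <- iota 0 (size g), j <- iota 0 (x n' i)]
  else [:: [::]].

Definition vertices (x : nat -> nat -> nat) : set (seq nat) :=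
  [set v | exists n, v \in generation x n].

Definition is_pmf (R : realType) (f : nat -> R) : Prop :=
  (forall k, 0 <= f k) /\ (\sum_(k <oo) (f k)%:E = 1)%E.

Definition has_mean (R : realType) (f : nat -> R) (a : R) : Prop :=
  (\sum_(k <oo) (k%:R * f k)%:E = a%:E)%E.

Definition has_mean_variance (R : realType) (f : nat -> R) (a v : R) : Prop :=
  has_mean f a /\ (\sum_(k <oo) ((k%:R - a) ^+ 2 * f k)%:E = v%:E)%E.

Definition mutually_independent d d' (T : measurableType d)
    (T' : measurableType d') (R : realType) (P : probability T R)
    (I : choiceType) (Y : I -> {RV P >-> T'}) : Prop :=
  forall (J : {fset I}) (A : I -> set T'),
    (forall i, i \in J -> measurable (A i)) ->
    P (\bigcap_(i in [set` J]) (Y i @^-1` A i)) =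
      (\prod_(i <- J) P (Y i @^-1` A i))%E.

Definition is_offspring_family d (T : measurableType d) (R : realType)
    (P : probability T R) (f : nat -> nat -> R)
    (X : nat -> nat -> {RV P >-> nat}) : Prop :=
  (forall n i k, P (X n i @^-1` [set k]) = (f n k)%:E) /\
  mutually_independent (fun a : nat * nat => X a.1 a.2).

Definition gen_size d (T : measurableType d) (R : realType)
    (P : probability T R) (X : nat -> nat -> {RV P >-> nat}) (n : nat) (w : T)
    : R :=
  (size (generation (fun n' i => X n' i w) n))%:R.

Definition tree_size d (T : measurableType d) (R : realType)
    (P : probability T R) (X : nat -> nat -> {RV P >-> nat}) (w : T) : \bar R :=
  counting (vertices (fun n i => X n i w)).

Definition emean d (T : measurableType d) (R : realType)
    (P : probability T R) (Y : T -> \bar R) : \bar R := (\int[P]_w Y w)%E.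

(* As y - +oo = -oo for every y : \bar R, the variance is +oo if the mean is. *)
Definition evariance d (T : measurableType d) (R : realType)
    (P : probability T R) (Y : T -> \bar R) : \bar R :=
  (\int[P]_w (Y w - emean P Y) ^+ 2)%E.

(* Main.v *)
(* Write Z_(n+1) as a sum over i < Z_n of X_(n,i). An event A with the property
   that each A /\ {Z_n = c} is independent of the offspring counts of the
   generations >= n keeps this property for n + 1, and {Z_n = a} has it for
   every later generation. Splitting integrals over the countably many fibres
   of Z_n then gives E(Z_(n+1); A) = mu_n E(Z_n; A) and
   E(Z_(n+1)^2) = sigma_n^2 E(Z_n) + mu_n^2 E(Z_n^2), hence the moments of Z_n.
   For Z = sum_n Z_n, the identity
   (sum_n z_n)^2 = sum_n (z_n^2 + 2 z_n sum_(k >= 1) z_(n+k)) in [0, +oo],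
   applied once to the Z_n inside the expectation and once to the m_n, gives
   E(Z^2) = (asserted series) + m^2. *)
Require Import Defs.
From HB Require Import structures.
From mathcomp Require Import all_boot all_order all_algebra finmap.
From mathcomp Require Import all_classical all_reals all_analysis.
From mathcomp Require Import measurable_realfun.
From mathcomp Require Import ring.

Set Implicit Arguments.
Unset Strict Implicit.
Unset Printing Implicit Defensive.

Import Order.TTheory GRing.Theory Num.Theory.
Import numFieldNormedType.Exports.

Local Open Scope classical_set_scope.
Local Open Scope ring_scope.

(** * Squares of series in [0, +oo] *)

Lemma ge0_sqreD (R : realType) (a b : \bar R) : (0 <= a -> 0 <= b ->
  (a + b) * (a + b) = (a * a + 2%:E * a * b) + b * b)%E.
Proof.
move=> a0 b0; rewrite ge0_muleDl ?adde_ge0// !ge0_muleDr//.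
rewrite (muleC b a) -muleA -[2%R]/(1 + 1)%R EFinD ge0_muleDl ?mule_ge0// mul1e.
by rewrite !addeA.
Qed.

(** Squaring [u n = z n + u n.+1] gives [q n] plus the square of [u n.+1], so sums of [q] telescope
    below the square of [u 0]. The same expansion with truncated tails bounds the squares of partial
    sums by sums of [q]; the limit gives the converse inequality. *)
Lemma nneseries_sqr (R : realType) (z : nat -> \bar R) :
    (forall n, 0 <= z n)%E ->
  ((\sum_(n <oo) z n) * (\sum_(n <oo) z n) =
   \sum_(n <oo) (z n * z n + 2%:E * z n * \sum_(1 <= k <oo) z (n + k)%N))%E.
Proof.
move=> z0; pose u n := (\sum_(n <= k <oo) z k)%E.
have u0 n : (0 <= u n)%E by apply: nneseries_ge0.
have uS n : (u n = z n + u n.+1)%E.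
  by rewrite /u (nneseries_split n 1)// addn1 big_nat1.
pose q n := (z n * z n + 2%:E * z n * u n.+1)%E.
have q0 n : (0 <= q n)%E by rewrite adde_ge0 ?mule_ge0.
rewrite [RHS](_ : _ = \sum_(n <oo) q n)%E; last first.
  apply: eq_eseriesr => n _; congr (_ + _ * _)%E.
  rewrite -(@nneseries_addn _ (fun k => z (n + k)%N) 1)//.
  rewrite /u -(@nneseries_addn _ z n.+1)//.
  by apply: eq_eseriesr => i _; rewrite addnCA addn1.
have upper N n : (\sum_(n <= i < n + N) q i <= u n * u n)%E.
  elim: N n => [|N IH] n; first by rewrite addn0 big_geq// mule_ge0.
  rewrite big_ltn ?addnS ?ltnS ?leq_addr// (uS n) ge0_sqreD//.
  by rewrite leeD2l// -addSn IH.
have lower N n : ((\sum_(n <= i < n + N) z i) * (\sum_(n <= i < n + N) z i)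
    <= \sum_(n <= i < n + N) q i)%E.
  elim: N n => [|N IH] n; first by rewrite addn0 !big_geq// mule0.
  have nN : (n < n + N.+1)%N by rewrite addnS ltnS leq_addr.
  rewrite !(big_ltn nN) ge0_sqreD ?sume_ge0// -addSnnS.
  rewrite leeD ?IH// leeD2l// lee_wpmul2l ?mule_ge0//.
  exact: nneseries_lim_ge.
apply/eqP; rewrite eq_le; apply/andP; split.
  have cu : (\sum_(0 <= k < n) z k)%E @[n --> \oo] --> u 0%N.
    exact: is_cvg_nneseries.
  have cuu : ((\sum_(0 <= k < n) z k) * (\sum_(0 <= k < n) z k))%E @[n --> \oo]
      --> (u 0%N * u 0%N)%E.
    apply: cvgeM => //.
    (* The limit is a square, hence not the indeterminate product of 0 and +oo. *)
    by rewrite /mule_def; case: (u 0%N) (u0 0%N) => //= r; rewrite ?andbF// orbF.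
  rewrite -/(u 0%N) -(cvg_lim _ cuu)//.
  apply: lime_le; first by apply/cvg_ex; exists (u 0%N * u 0%N)%E.
  apply: nearW => n /=; apply: le_trans (lower n 0%N) _.
  exact: nneseries_lim_ge.
apply: lime_le; first exact: is_cvg_nneseries.
by apply: nearW => n; exact: upper n 0%N.
Qed.

(** * The number of vertices as a series of generation sizes *)

Lemma size_generation x n v : v \in generation x n -> size v = n.
Proof.
elim: n v => [|n IH] v /=; first by rewrite inE => /eqP ->.
move=> /allpairsPdep[i [j []]]; rewrite mem_iota => /andP[_ ig] _ ->.
by rewrite size_rcons IH// mem_nth.
Qed.

Lemma generation_uniq x n : uniq (generation x n).
Proof.
elim: n => [//|n IH] /=; apply: allpairs_uniq_dep.
- exact: iota_uniq.
- by move=> i _; exact: iota_uniq.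
move=> _ _ /allpairsPdep[i [j [ig _ ->]]] /allpairsPdep[i' [j' [ig' _ ->]]] /=.
move=> /rcons_inj[/eqP + ->]; rewrite nth_uniq// => [/eqP->//||].
- by move: ig; rewrite mem_iota.
- by move: ig'; rewrite mem_iota.
Qed.

Lemma counting_card_eq (R : realType) (U V : choiceType) (A : set U)
  (B : set V) : (A #= B)%card -> counting A = counting B :> \bar R.
Proof.
move=> AB; rewrite /counting (eq_finite_set AB).
case: asboolP => // fB; congr (_%:R%:E); apply/fcard_eq => //.
by rewrite (eq_finite_set AB).
Qed.

Lemma counting_uniq_seq (R : realType) (U : choiceType) (s : seq U) :
  uniq s -> counting [set` s] = (size s)%:R%:E :> \bar R.
Proof.
move=> us; rewrite /counting asboolT//; congr (_%:R%:E).
rewrite (_ : fset_set _ = [fset v in s]%fset) ?card_fseq ?undup_id//.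
by apply/fsetP => v; rewrite in_fset_set// !inE; apply/idP/idP;
  rewrite ?in_setE ?mem_setE.
Qed.

(** Words of generation [n] have length [n], so the generations are disjoint and the counting
    measure adds up over them. *)
Lemma counting_vertices (R : realType) x : counting (vertices x) =
  (\sum_(n <oo) (size (generation x n))%:R%:E)%E :> \bar R.
Proof.
(* Words are coded injectively by natural numbers, where sigma-additivity of the counting measure is
   applied. *)
pose F n : set nat := choice.pickle @` [set` generation x n].
have pinj (A : set (seq nat)) : {in A &, injective choice.pickle}.
  by move=> u v _ _; exact: (pcan_inj choice.pickleK).
transitivity (@counting nat R (\bigcup_n F n)).
  rewrite -image_bigcup; apply: counting_card_eq; rewrite card_eq_sym.
  rewrite (_ : vertices x = \bigcup_n [set` generation x n]).
    exact: inj_card_eq.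
  by apply/seteqP; split=> v [n]; [exists n|exists n].
rewrite measure_semi_bigcup//.
  apply: eq_eseriesr => n _; rewrite -counting_uniq_seq ?generation_uniq//.
  exact/counting_card_eq/inj_card_eq.
apply/trivIsetP => i j _ _ ij; apply/seteqP; split=> // _ [[u ui <-] [v vj vu]].
move: ij; rewrite -(size_generation ui) -(size_generation vj).
by rewrite (pcan_inj choice.pickleK vu) eqxx.
Qed.

(** * Slicing along the fibres of a variable with values in [nat] *)

Section nat_valued.
Context d (T : measurableType d) (R : realType) (P : probability T R).
Implicit Types (A : set T) (Y : T -> nat) (F : T -> \bar R).

Lemma measurable_fun_fibers Y :
  (forall k, measurable (Y @^-1` [set k])) -> measurable_fun setT Y.
Proof.
move=> mY _ B _; rewrite setTI.
rewrite (_ : Y @^-1` B = \bigcup_(k in B) Y @^-1` [set k]).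
  exact: bigcup_measurable.
by apply/seteqP; split => [w Bw|w [k Bk] /= ->//]; exists (Y w).
Qed.

Lemma measurable_fiber Y k :
  measurable_fun setT Y -> measurable (Y @^-1` [set k]).
Proof. by move=> mY; rewrite -[X in measurable X]setTI; exact: mY. Qed.

(** The random index is constant on each fibre of [Y]; this covers sums with a random number of
    terms. *)
Lemma measurable_fun_dep Y (G : nat -> T -> nat) : measurable_fun setT Y ->
    (forall k, measurable_fun setT (G k)) ->
  measurable_fun setT (fun w => G (Y w) w).
Proof.
move=> mY mG; apply: measurable_fun_fibers => b.
rewrite (_ : _ @^-1` _ =
    \bigcup_c (Y @^-1` [set c] `&` G c @^-1` [set b])).
  by apply: bigcup_measurable => c _; apply: measurableI; apply: measurable_fiber.
by apply/seteqP; split => [w Gw|w [c _ []] /= <-//]; exists (Y w).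
Qed.

Lemma measurable_fun_comp_nat d' (T' : measurableType d') Y (g : nat -> T') :
  measurable_fun setT Y -> measurable_fun setT (g \o Y).
Proof. by move=> mY; apply: measurableT_comp. Qed.

Lemma ge0_integral_fibers Y A F : measurable_fun setT Y -> measurable A ->
    measurable_fun setT F -> (forall w, 0 <= F w)%E ->
  (\int[P]_(w in A) F w =
   \sum_(k <oo) \int[P]_(w in A `&` Y @^-1` [set k]) F w)%E.
Proof.
move=> mY mA mF F0.
have AE : A = \bigcup_k (A `&` Y @^-1` [set k]).
  by apply/seteqP; split => [w Aw|w [k _ []]//]; exists (Y w).
rewrite {1}AE ge0_integral_bigcup//.
- by move=> k; apply: measurableI => //; exact: measurable_fiber.
- exact: measurable_funTS.
- by apply/trivIsetP => i j _ _ ij; apply/seteqP; split => // w;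
    move=> [[_ /= wi] [_ /= wj]];
    rewrite -wi wj eqxx in ij.
Qed.

Lemma measure_fibers Y A : measurable_fun setT Y -> measurable A ->
  (P A = \sum_(k <oo) P (A `&` Y @^-1` [set k]))%E.
Proof.
move=> mY mA; rewrite -[LHS]mul1e -integral_cst// (ge0_integral_fibers mY)//.
apply: eq_eseriesr => k _; rewrite integral_cst ?mul1e//.
by apply: measurableI => //; exact: measurable_fiber.
Qed.

Lemma ge0_integral_nat Y A (phi : nat -> \bar R) : measurable_fun setT Y ->
    measurable A -> (forall k, 0 <= phi k)%E ->
  (\int[P]_(w in A) phi (Y w) =
   \sum_(k <oo) phi k * P (A `&` Y @^-1` [set k]))%E.
Proof.
move=> mY mA phi0; rewrite (ge0_integral_fibers mY)//; last first.
  exact: measurable_fun_comp_nat.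
apply: eq_eseriesr => k _; rewrite -integral_cst; last first.
  by apply: measurableI => //; exact: measurable_fiber.
by apply: eq_integral => w /set_mem[_ /= <-].
Qed.

End nat_valued.

(** * Events independent of a set of offspring counts *)

Section independence.
Context d (T : measurableType d) (R : realType) (P : probability T R).
Context (f : nat -> nat -> R) (X : nat -> nat -> {RV P >-> nat}).
Hypothesis hX : is_offspring_family f X.
Implicit Types (Q : pred (nat * nat)) (A : set T).

Lemma measurable_offspring n i : measurable_fun setT (X n i).
Proof. exact: measurable_funPT. Qed.

(* [f j.1 (k j)] is the probability of [X j.1 j.2 = k j]. *)
Definition indep_of Q A := measurable A /\
  forall (J : {fset nat * nat}) (k : nat * nat -> nat), {subset J <= Q} ->
    (P (A `&` \bigcap_(j in [set` J]) (X j.1 j.2 @^-1` [set k j])) =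
     P A * (\prod_(j <- J) f j.1 (k j))%:E)%E.

Lemma indep_of_setT Q : indep_of Q setT.
Proof.
split=> // J k _; rewrite setTI probability_setT mul1e.
rewrite (hX.2 J (fun j => [set k j]))// -prodEFin.
by apply: eq_bigr => j _; rewrite hX.1.
Qed.

Lemma indep_of_set0 Q : indep_of Q set0.
Proof. by split=> // J k _; rewrite set0I measure0 mul0e. Qed.

Lemma sub_indep_of Q Q' A :
  {subset Q' <= Q} -> indep_of Q A -> indep_of Q' A.
Proof.
by move=> Q'Q [mA iA]; split=> // J k JQ'; apply: iA => j /JQ' /Q'Q.
Qed.

(** Both sides of the product rule are sigma-additive in the event, so independence can be checked
    slice by slice. *)
Lemma indep_of_fibers Q A (Y : T -> nat) :
    measurable A -> measurable_fun setT Y ->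
    (forall k, indep_of Q (A `&` Y @^-1` [set k])) ->
  indep_of Q A.
Proof.
move=> mA mY iA; split=> // J k JQ; set C := \bigcap_(j in _) _.
have mC : measurable C.
  apply: fin_bigcap_measurable => // j _.
  exact/measurable_fiber/measurable_offspring.
rewrite (measure_fibers P mY (measurableI _ _ mA mC)) muleC.
rewrite (measure_fibers P mY mA) -nneseriesZl//.
by apply: eq_eseriesr => c _; rewrite setIAC (iA c).2// muleC.
Qed.

Lemma indep_of_fiber_cst Q A (Y : T -> nat) c b :
  (forall w, A w -> Y w = c) -> indep_of Q A ->
  indep_of Q (A `&` Y @^-1` [set b]).
Proof.
move=> Yc iA; have [cb|cb] := eqVneq c b.
  rewrite (_ : _ `&` _ = A)//; apply/seteqP; split=> [w []//|w Aw].
  by split=> //=; rewrite Yc.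
rewrite (_ : _ `&` _ = set0); first exact: indep_of_set0.
by apply/seteqP; split=> // w [/Yc /= -> /eqP]; rewrite (negPf cb).
Qed.

Lemma probability_indep_of_fiber Q A n i k : indep_of Q A -> Q (n, i) ->
  (P (A `&` X n i @^-1` [set k]) = P A * (f n k)%:E)%E.
Proof.
move=> [mA iA] Qni.
have := iA [fset (n, i)]%fset (fun=> k); rewrite set_fset1 bigcap_set1 => ->.
  by rewrite big_seq_fset1.
by move=> j; rewrite !inE => /eqP ->.
Qed.

(** The product rule for [A], applied to [J] with [(n, i)] added, gives the rule for the smaller
    event once [(n, i)] has left the index set. *)
Lemma indep_of_fiber Q Q' A n i k : indep_of Q A -> Q (n, i) ->
    (forall q, Q' q -> Q q /\ q != (n, i)) ->
  indep_of Q' (A `&` X n i @^-1` [set k]).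
Proof.
move=> iA Qni Q'Q; have [mA iA'] := iA; split.
  exact/measurableI/measurable_fiber/measurable_offspring.
move=> J l JQ'; rewrite (probability_indep_of_fiber _ iA Qni).
have niJ : (n, i) \notin J.
  by apply/negP => /JQ' /Q'Q[_]; rewrite eqxx.
pose l' j := if j == (n, i) then k else l j.
have l'E j : j \in J -> l' j = l j.
  by rewrite /l'; case: eqP => // ->; rewrite (negPf niJ).
have := iA' ((n, i) |` J)%fset l'.
rewrite set_fsetU1 bigcap_setU1 /= big_fsetU1//= {1 3}/l' eqxx => e.
have -> : \prod_(j <- J) f j.1 (l j) = \prod_(j <- J) f j.1 (l' j).
  by apply: eq_big_seq => j /l'E ->.
rewrite -muleA -EFinM -e; last first.
  by move=> j; rewrite !inE => /orP[/eqP->//|/JQ' /Q'Q[]].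
rewrite -setIA; congr (P (_ `&` (_ `&` _))).
by apply: eq_bigcapr => j /= /l'E ->.
Qed.

(** The pairs at or after [(n, c)] in lexicographic order: the counts still unexposed when all
    earlier ones have been revealed. *)
Definition from n c : pred (nat * nat) :=
  [pred q | (n < q.1)%N || (q.1 == n) && (c <= q.2)%N].

Definition offspring_sum n c w := (\sum_(i < c) X n i w)%N.

Lemma measurable_offspring_sum n c : measurable_fun setT (offspring_sum n c).
Proof.
elim: c => [|c IH].
  rewrite (_ : offspring_sum n 0 = cst 0%N)//.
  by apply/funext => w; rewrite /offspring_sum big_ord0.
rewrite (_ : offspring_sum _ _ = fun w => (offspring_sum n c w + X n c w)%N).
  apply: (measurable_fun_dep (G := fun k w => (k + X n c w)%N)) => // k.
  exact/(measurable_fun_comp_nat (addn k))/measurable_offspring.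
by apply/funext => w; rewrite /offspring_sum big_ord_recr.
Qed.

(** The counts of generation [n] are exposed one at a time: on [X n c = k], the sum of [c.+1] terms
    is [b] exactly if the sum of [c] terms is [b - k], and [indep_of_fiber] removes [(n, c)] from
    the index set. *)
Lemma indep_of_offspring_sum A n c b : indep_of (from n 0) A ->
  indep_of (from n c) (A `&` offspring_sum n c @^-1` [set b]).
Proof.
move=> iA; elim: c b => [|c IH] b.
  by apply: (indep_of_fiber_cst (c := 0%N)) => // w _; exact: big_ord0.
apply: (indep_of_fibers _ (measurable_offspring n c)) => [|k].
  apply: measurableI; first exact: iA.1.
  exact/measurable_fiber/measurable_offspring_sum.
have step a : indep_of (from n c.+1)
    (A `&` offspring_sum n c @^-1` [set a] `&` X n c @^-1` [set k]).
  apply: (indep_of_fiber _ (IH a)) => [|[n' i]].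
    by rewrite /from /= eqxx leqnn orbT.
  rewrite /from /= => /orP[nn'|/andP[/eqP-> ci]].
    by rewrite nn'; split=> //; rewrite xpair_eqE (gtn_eqF nn').
  by rewrite eqxx (ltnW ci) orbT; split=> //; rewrite xpair_eqE (gtn_eqF ci) andbF.
have E w : offspring_sum n c.+1 w = (offspring_sum n c w + X n c w)%N.
  exact: big_ord_recr.
(* Subtraction in [nat] is truncated, so [k > b] is treated apart; the event is then empty. *)
have [kb|bk] := leqP k b.
  rewrite (_ : _ `&` _ `&` _ =
    A `&` offspring_sum n c @^-1` [set b - k]%N `&` X n c @^-1` [set k])//.
  apply/seteqP; split=> w [[Aw /=] + Xk].
    by rewrite E Xk => Sb; split=> //; split=> //=; rewrite -Sb addnK.
  by move=> Sb; split=> //; split=> //=; rewrite E Xk Sb subnK.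
rewrite (_ : _ `&` _ `&` _ = set0); first exact: indep_of_set0.
apply/seteqP; split=> // w [[_ /=]]; rewrite E => Sb Xk.
by move: bk; rewrite -Sb Xk ltnNge leq_addl.
Qed.

(** * Generation sizes and the events known at a generation *)

Definition gsize n w := size (generation (fun n' i => X n' i w) n).

Lemma gsizeS n w : gsize n.+1 w = offspring_sum n (gsize n w) w.
Proof.
rewrite /gsize /= size_allpairs_dep sumnE big_map /offspring_sum.
rewrite -(big_mkord xpredT (fun i => X n i w)) /index_iota subn0.
by apply: eq_bigr => i _; rewrite size_iota.
Qed.

Lemma measurable_gsize n : measurable_fun setT (gsize n).
Proof.
elim: n => [|n IH]; first exact: measurable_cst.
rewrite (_ : gsize _ = fun w => offspring_sum n (gsize n w) w).
  by apply: measurable_fun_dep => // k; exact: measurable_offspring_sum.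
by apply/funext => w; exact: gsizeS.
Qed.

(* Satisfied in particular by the events determined by the sizes of the
   generations up to n. *)
Definition known n A := measurable A /\
  forall c, indep_of (from n 0) (A `&` gsize n @^-1` [set c]).

(** On [gsize n = c] the next size is a sum with the fixed number [c] of terms, so
    [indep_of_offspring_sum] applies to each slice and [indep_of_fibers] glues the slices. *)
Lemma knownS n A : known n A -> known n.+1 A.
Proof.
move=> [mA kA]; split=> // b.
apply: (indep_of_fibers _ (measurable_gsize n)) => [|c].
  exact/measurableI/measurable_fiber/measurable_gsize.
rewrite (_ : _ `&` _ `&` _ =
    A `&` gsize n @^-1` [set c] `&` offspring_sum n c @^-1` [set b]).
  apply: (sub_indep_of (Q := from n c)); last exact: indep_of_offspring_sum.
  move=> [n' i]; rewrite /from !inE /= leq0n andbT => /orP[/ltnW->//|/eqP->].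
  by rewrite ltnSn.
apply/seteqP; split=> w [[Aw /= Zw] Zw'].
  by split=> //=; rewrite -[in LHS]Zw' -gsizeS.
by split=> //; split=> //=; rewrite gsizeS Zw.
Qed.

Lemma known_setT n : known n setT.
Proof.
elim: n => [|n /knownS//]; split=> // c.
(* Generation 0 is the root alone, whence the constant 1. *)
by apply: (indep_of_fiber_cst (c := 1%N)); last exact: indep_of_setT.
Qed.

(** For [k = 0] the size is constant on the event, so each slice is the whole event or empty;
    [knownS] leads on to later generations. *)
Lemma known_gsize n k a : known (n + k) (gsize n @^-1` [set a]).
Proof.
elim: k => [|k IH]; last by rewrite addnS; exact: knownS.
rewrite addn0; split=> [|c]; first exact/measurable_fiber/measurable_gsize.
apply: (indep_of_fiber_cst (c := a)) => //.
by have := (known_setT n).2 a; rewrite setTI.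
Qed.

(** * Moments of offspring counts and their sums *)

Section moments.
Context (mu sigma : nat -> R).
Hypothesis hf : forall n, is_pmf (f n).
Hypothesis hmom : forall n, has_mean_variance (f n) (mu n) (sigma n ^+ 2).

Lemma mu_ge0 n : 0 <= mu n.
Proof.
rewrite -lee_fin -(hmom n).1; apply: nneseries_ge0 => k _ _.
by rewrite lee_fin mulr_ge0// (hf n).1.
Qed.

Lemma second_moment n :
  (\sum_(k <oo) (k%:R ^+ 2 * f n k)%:E = (sigma n ^+ 2 + mu n ^+ 2)%:E)%E.
Proof.
have f0 k : 0 <= f n k by apply: (hf n).1.
have m0 := mu_ge0 n.
(* This is the expansion of the square with the mixed term moved across: all terms are nonnegative,
   so both series may be split. *)
have : (\sum_(k <oo) ((k%:R ^+ 2 * f n k)%:E + (mu n ^+ 2)%:E * (f n k)%:E) =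
    \sum_(k <oo) (((k%:R - mu n) ^+ 2 * f n k)%:E
      + (mu n *+ 2)%:E * (k%:R * f n k)%:E))%E.
  apply: eq_eseriesr => k _; rewrite -!EFinM -!EFinD; congr EFin.
  by rewrite mulr2n; ring.
rewrite !nneseriesD; do ?[move=> k _ _;
  by rewrite ?mule_ge0 ?lee_fin ?mulrn_wge0// mulr_ge0// ?sqr_ge0].
rewrite !nneseriesZl; do ?[by move=> k _; rewrite lee_fin ?mulr_ge0].
rewrite (hf n).2 (hmom n).2 (hmom n).1 mule1 -EFinM -EFinD => e.
rewrite -[LHS](@addeK _ (mu n ^+ 2)%:E)// e -EFinB; congr EFin.
by rewrite mulr2n; ring.
Qed.

(** A zero mean forces every [k%:R * f n k] to be 0, these terms being nonnegative, and the second
    moment vanishes as well. This settles the quotients by a vanishing mean size. *)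
Lemma sigma_eq0 n : mu n = 0 -> sigma n = 0.
Proof.
move=> mu0; have f0 k : 0 <= f n k by apply: (hf n).1.
apply/eqP; rewrite -sqrf_eq0; apply/eqP.
have := second_moment n; rewrite mu0 expr0n addr0 eseries0 => [[<-//]|k _ _].
congr EFin; have : k%:R * f n k = 0.
  apply/eqP; rewrite eq_le mulr_ge0// andbT -lee_fin -mu0 -(hmom n).1.
  have t0 i : (0 <= (i%:R * f n i)%:E)%E by rewrite lee_fin mulr_ge0.
  apply: (@le_trans _ _ (\sum_(0 <= i < k.+1) (i%:R * f n i)%:E)%E).
    by rewrite big_nat_recr//= leeDr// sume_ge0.
  exact: nneseries_lim_ge.
by rewrite expr2 -mulrA => ->; rewrite mulr0.
Qed.

Lemma integral_offspring_comp Q A n i (phi : nat -> R) : indep_of Q A ->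
    Q (n, i) -> (forall k, 0 <= phi k) ->
  (\int[P]_(w in A) (phi (X n i w))%:E =
   P A * \sum_(k <oo) (phi k * f n k)%:E)%E.
Proof.
move=> iA Qni phi0.
rewrite (@ge0_integral_nat _ _ _ _ (X n i) A (fun k => (phi k)%:E)); last first.
- by move=> k; rewrite lee_fin.
- exact: iA.1.
- exact: measurable_offspring.
rewrite -(fineK (fin_num_measure P A iA.1)) -nneseriesZl; last first.
  by move=> k _; rewrite lee_fin mulr_ge0// (hf n).1.
apply: eq_eseriesr => k _; rewrite (probability_indep_of_fiber _ iA Qni).
by rewrite (fineK (fin_num_measure P A iA.1)) muleCA EFinM.
Qed.

Lemma integral_offspring Q A n i : indep_of Q A -> Q (n, i) ->
  (\int[P]_(w in A) (X n i w)%:R%:E = P A * (mu n)%:E)%E.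
Proof.
move=> iA Qni; rewrite -(hmom n).1.
exact: (integral_offspring_comp (phi := fun k => k%:R)) iA Qni _.
Qed.

Lemma integral_offspring_sqr Q A n i : indep_of Q A -> Q (n, i) ->
  (\int[P]_(w in A) ((X n i w)%:R ^+ 2)%:E =
   P A * (sigma n ^+ 2 + mu n ^+ 2)%:E)%E.
Proof.
move=> iA Qni; rewrite -second_moment.
apply: (integral_offspring_comp (phi := fun k => k%:R ^+ 2)) iA Qni _ => k.
exact: sqr_ge0.
Qed.

Lemma measurable_natr_comp (Y : T -> nat) (phi : nat -> R) :
  measurable_fun setT Y -> measurable_fun setT (fun w => (phi (Y w))%:E).
Proof. exact: (measurable_fun_comp_nat (fun k => (phi k)%:E)). Qed.

(** On the slice [X n i = k] the first factor is constant and, as [i != j], the slice is still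
    independent of [X n j]. Summing over [k] restores the integral of [X n i]. *)
Lemma integral_offspringM Q A n i j : indep_of Q A -> Q (n, i) -> Q (n, j) ->
    i != j ->
  (\int[P]_(w in A) ((X n i w)%:R * (X n j w)%:R)%:E =
   P A * (mu n ^+ 2)%:E)%E.
Proof.
move=> iA Qni Qnj ij; have mA := iA.1.
rewrite (ge0_integral_fibers P (measurable_offspring n i)) //.
- rewrite expr2 EFinM muleA -(integral_offspring iA Qni) muleC.
  rewrite (ge0_integral_fibers P (measurable_offspring n i)) //; last first.
    exact/(measurable_natr_comp (fun k => k%:R))/measurable_offspring.
  rewrite -nneseriesZl; last by move=> k _; apply: integral_ge0.
  apply: eq_eseriesr => k _.
  have iAk : indep_of [pred q | Q q & q != (n, i)]
      (A `&` X n i @^-1` [set k]).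
    by apply: (indep_of_fiber _ iA Qni) => q /andP[].
  have Qj : [pred q | Q q & q != (n, i)] (n, j).
    by rewrite /= [Q _]Qnj xpair_eqE eqxx eq_sym.
  transitivity (\int[P]_(w in A `&` X n i @^-1` [set k])
      (k%:R%:E * (X n j w)%:R%:E))%E.
    by apply: eq_integral => w /set_mem[_ /= <-]; rewrite EFinM.
  rewrite ge0_integralZl//; [|exact: iAk.1|].
  + rewrite (integral_offspring iAk Qj).
    transitivity ((mu n)%:E * (k%:R%:E * P (A `&` X n i @^-1` [set k])))%E.
      by rewrite muleA muleC muleCA muleA.
    congr (_ * _)%E; rewrite -integral_cst; last exact: iAk.1.
    by apply: eq_integral => w /set_mem[_ /= ->].
  + apply: measurable_funTS.
    exact/(measurable_natr_comp (fun k => k%:R))/measurable_offspring.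
- under eq_fun do rewrite EFinM; apply: emeasurable_funM;
  exact/(measurable_natr_comp (fun k => k%:R))/measurable_offspring.
Qed.

Lemma integral_offspring_sum A n c : indep_of (from n 0) A ->
  (\int[P]_(w in A) (offspring_sum n c w)%:R%:E = P A * (c%:R * mu n)%:E)%E.
Proof.
move=> iA.
under eq_integral do rewrite /offspring_sum natr_sum -sumEFin.
rewrite ge0_integral_sum//; [|exact: iA.1|move=> i].
- under eq_bigr.
    move=> i _; rewrite (integral_offspring iA); last by rewrite /from /= eqxx orbT.
    over.
  rewrite -ge0_sume_distrr; last by move=> i _; rewrite lee_fin mu_ge0.
  by rewrite sumEFin sumr_const card_ord mulr_natl.
- apply: measurable_funTS.
  exact/(measurable_natr_comp (fun k => k%:R))/measurable_offspring.
Qed.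

Lemma integral_offspring_sum_sqr A n c : indep_of (from n 0) A ->
  (\int[P]_(w in A) ((offspring_sum n c w)%:R ^+ 2)%:E =
   P A * (c%:R * sigma n ^+ 2 + c%:R ^+ 2 * mu n ^+ 2)%:E)%E.
Proof.
move=> iA.
have Qn i : from n 0 (n, i) by rewrite /from /= eqxx orbT.
have mX i j : measurable_fun A
    (fun w => ((X n i w)%:R * (X n j w)%:R)%:E : \bar R).
  apply: measurable_funTS; under eq_fun do rewrite EFinM.
  by apply: emeasurable_funM;
    exact/(measurable_natr_comp (fun k => k%:R))/measurable_offspring.
have XX0 i j w : (0 <= ((X n i w)%:R * (X n j w)%:R)%:E :> \bar R)%E.
  by rewrite lee_fin mulr_ge0.
transitivity (\int[P]_(w in A) \sum_(i < c) \sum_(j < c)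
    ((X n i w)%:R * (X n j w)%:R)%:E)%E.
  apply: eq_integral => w _; under eq_bigr do rewrite sumEFin.
  rewrite sumEFin /offspring_sum natr_sum expr2 mulr_suml.
  by congr EFin; apply: eq_bigr => i _; rewrite mulr_sumr.
rewrite ge0_integral_sum//; [|exact: iA.1| |]; first last.
- by move=> i w _; apply: sume_ge0.
- by move=> i; exact: emeasurable_sum.
(* Up to the factor [P A], each pair contributes [mu n ^+ 2], and each diagonal one a further
   [sigma n ^+ 2]. *)
transitivity (\sum_(i < c) \sum_(j < c)
    P A * (mu n ^+ 2 + (j == i)%:R * sigma n ^+ 2)%:E)%E.
  apply: eq_bigr => i _; rewrite ge0_integral_sum//; last exact: iA.1.
  apply: eq_bigr => j _; have [->|ji] := eqVneq.
    rewrite mul1r addrC -(integral_offspring_sqr iA (Qn i)).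
    by apply: eq_integral.
  by rewrite mul0r addr0 (integral_offspringM iA)// eq_sym.
have t0 (b : bool) : (0 <= (mu n ^+ 2 + b%:R * sigma n ^+ 2)%:E)%E.
  by rewrite lee_fin addr_ge0 ?sqr_ge0// mulr_ge0// sqr_ge0.
under eq_bigr do rewrite -ge0_sume_distrr//.
rewrite -ge0_sume_distrr; last by move=> i _; exact: sume_ge0.
congr (_ * _)%E; under eq_bigr do rewrite sumEFin; rewrite sumEFin; congr EFin.
under eq_bigr => i _.
  rewrite big_split/= sumr_const card_ord (bigD1 i)//= eqxx mul1r big1; last first.
    by move=> j /negPf ->; rewrite mul0r.
  rewrite addr0; over.
by rewrite sumr_const card_ord -[LHS]mulr_natl -(mulr_natl (mu n ^+ 2)); ring.
Qed.

(** Here [phi c] acts as the conditional expectation of [F] given [gsize n = c]; recursions for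
    moments reduce to sums with a fixed number of terms. *)
Lemma integral_known A n (F : T -> \bar R) (phi : nat -> R) :
    known n A -> measurable_fun setT F -> (forall w, 0 <= F w)%E ->
    (forall c, 0 <= phi c) ->
    (forall c, indep_of (from n 0) (A `&` gsize n @^-1` [set c]) ->
      \int[P]_(w in A `&` gsize n @^-1` [set c]) F w =
      P (A `&` gsize n @^-1` [set c]) * (phi c)%:E)%E ->
  (\int[P]_(w in A) F w = \int[P]_(w in A) (phi (gsize n w))%:E)%E.
Proof.
move=> [mA kA] mF F0 phi0 FE.
rewrite (ge0_integral_fibers P (measurable_gsize n))//.
rewrite (ge0_integral_nat P (measurable_gsize n) mA (phi := fun c => (phi c)%:E)).
  by apply: eq_eseriesr => c _; rewrite FE// muleC.
by move=> c; rewrite lee_fin.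
Qed.

(** * Moments of the generation sizes *)

Lemma measurable_gsize_comp n (phi : nat -> R) :
  measurable_fun setT (fun w => (phi (gsize n w))%:E).
Proof. exact/measurable_natr_comp/measurable_gsize. Qed.

Lemma integral_gsizeS A n : known n A ->
  (\int[P]_(w in A) (gsize n.+1 w)%:R%:E =
   (mu n)%:E * \int[P]_(w in A) (gsize n w)%:R%:E)%E.
Proof.
move=> kA.
rewrite (integral_known (phi := fun c => mu n * c%:R) kA)//.
- under eq_integral do rewrite EFinM.
  rewrite ge0_integralZl//; first exact: kA.1.
  + exact/measurable_funTS/(measurable_gsize_comp n (fun k => k%:R)).
  + by rewrite lee_fin mu_ge0.
- exact: (measurable_gsize_comp _ (fun k => k%:R)).
- by move=> c; rewrite mulr_ge0// mu_ge0.
- move=> c ic; rewrite mulrC -(integral_offspring_sum c ic).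
  by apply: eq_integral => w /set_mem[_ /= Zc]; rewrite gsizeS Zc.
Qed.

Lemma integral_gsize_add A n k : known n A ->
  (\int[P]_(w in A) (gsize (n + k) w)%:R%:E =
   (\prod_(n <= i < n + k) mu i)%:E * \int[P]_(w in A) (gsize n w)%:R%:E)%E.
Proof.
move=> kA; elim: k => [|k IH]; first by rewrite addn0 big_geq// mul1e.
have kAk : known (n + k) A.
  by elim: k {IH} => [|k IH]; rewrite ?addn0// addnS; exact: knownS.
rewrite addnS integral_gsizeS// IH big_nat_recr ?leq_addr//=.
by rewrite muleA -EFinM mulrC.
Qed.

Lemma integral_gsize n :
  (\int[P]_w (gsize n w)%:R%:E = (\prod_(0 <= i < n) mu i)%:E)%E.
Proof.
rewrite (integral_gsize_add n (known_setT 0)) -[RHS]mule1 add0n.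
congr (_ * _)%E; transitivity (\int[P]_w cst 1%E w)%E; first by [].
by rewrite integral_cst// mul1e; exact: probability_setT.
Qed.

(** The asserted closed form; that it is the variance is the case [k = 0] of
    [covariance_gen_size]. *)
Definition gsize_var n : R :=
  \sum_(0 <= i < n) sigma i ^+ 2 * (\prod_(0 <= j < i) mu j)
                   * (\prod_(i.+1 <= j < n) mu j ^+ 2).

Lemma gsize_varS n : gsize_var n.+1 =
  sigma n ^+ 2 * (\prod_(0 <= j < n) mu j) + mu n ^+ 2 * gsize_var n.
Proof.
rewrite /gsize_var big_nat_recr//= [X in _ * X]big_geq// mulr1 addrC.
congr (_ + _); rewrite big_distrr/=; apply: eq_big_nat => i /andP[_ iltn].
by rewrite big_nat_recr//= mulrA mulrC.
Qed.

(** Either the product vanishes before its last factor, or [mu n = 0] and then [sigma n = 0]. So a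
    quotient of variance by mean with denominator 0 has numerator 0. *)
Lemma gsize_var_eq0 n : \prod_(0 <= i < n) mu i = 0 -> gsize_var n = 0.
Proof.
elim: n => [_|n IH]; first by rewrite /gsize_var big_geq.
rewrite big_nat_recr//= gsize_varS => /eqP; rewrite mulf_eq0 => /orP[]/eqP e.
  by rewrite e IH// !mulr0 addr0.
by rewrite e (sigma_eq0 e) expr0n /= !mul0r addr0.
Qed.

Lemma gsize_var_ge0 n : 0 <= gsize_var n.
Proof.
elim: n => [|n IH]; first by rewrite /gsize_var big_geq.
rewrite gsize_varS addr_ge0// mulr_ge0// ?sqr_ge0// prodr_ge0// => i _.
exact: mu_ge0.
Qed.

Lemma integral_gsize_sqr n :
  (\int[P]_w ((gsize n w)%:R ^+ 2)%:E =
   (gsize_var n + (\prod_(0 <= i < n) mu i) ^+ 2)%:E)%E.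
Proof.
elim: n => [|n IH].
  rewrite /gsize_var !big_geq// expr1n add0r.
  transitivity (\int[P]_w cst 1%E w)%E; first by [].
  by rewrite integral_cst// mul1e; exact: probability_setT.
rewrite (@integral_known setT n _
    (fun c => sigma n ^+ 2 * c%:R + mu n ^+ 2 * c%:R ^+ 2)) //.
- under eq_integral do rewrite EFinD !EFinM.
  rewrite ge0_integralD//; first last.
  + exact/measurable_funeM/(measurable_gsize_comp n (fun k => k%:R ^+ 2)).
  + by move=> w _; rewrite mule_ge0// lee_fin sqr_ge0.
  + exact/measurable_funeM/(measurable_gsize_comp n (fun k => k%:R)).
  + by move=> w _; rewrite mule_ge0// lee_fin sqr_ge0.
  rewrite !ge0_integralZl//; do ?[by rewrite lee_fin sqr_ge0];
    do ?[by move=> w _; rewrite lee_fin sqr_ge0]; first last.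
  + exact: (measurable_gsize_comp n (fun k => k%:R)).
  + exact: (measurable_gsize_comp n (fun k => k%:R ^+ 2)).
  rewrite IH integral_gsize -!EFinM -EFinD gsize_varS big_nat_recr//=.
  by congr EFin; ring.
- exact: known_setT.
- exact: (measurable_gsize_comp _ (fun k => k%:R ^+ 2)).
- by move=> c; rewrite addr_ge0// mulr_ge0// sqr_ge0.
- move=> c ic; rewrite [X in (_ * X%:E)%E](_ : _ =
      c%:R * sigma n ^+ 2 + c%:R ^+ 2 * mu n ^+ 2); last by ring.
  rewrite -(integral_offspring_sum_sqr c ic).
  by apply: eq_integral => w /set_mem[_ /= Zc]; rewrite gsizeS Zc.
Qed.

(** On the fibre [gsize n = a] the first factor is the constant [a], and the fibre is a known event,
    so [integral_gsize_add] trades the later size for that of generation [n], up to the product of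
    the [mu i]. *)
Lemma integral_gsizeM n k :
  (\int[P]_w ((gsize n w)%:R * (gsize (n + k) w)%:R)%:E =
   ((\prod_(n <= i < n + k) mu i) *
    (gsize_var n + (\prod_(0 <= i < n) mu i) ^+ 2))%:E)%E.
Proof.
have mn := measurable_gsize n.
have m1 l := measurable_gsize_comp l (fun k => k%:R).
rewrite EFinM -integral_gsize_sqr !(ge0_integral_fibers P mn)//; first last.
- under eq_fun do rewrite EFinM.
  exact: emeasurable_funM.
- exact: (measurable_gsize_comp n (fun k => k%:R ^+ 2)).
rewrite -nneseriesZl; last first.
  by move=> a _; apply: integral_ge0 => w _; rewrite lee_fin sqr_ge0.
apply: eq_eseriesr => a _; rewrite setTI.
have ma : measurable (gsize n @^-1` [set a]) by exact: measurable_fiber.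
have ka := known_gsize n 0 a; rewrite addn0 in ka.
transitivity (a%:R%:E * \int[P]_(w in gsize n @^-1` [set a])
    (gsize (n + k) w)%:R%:E)%E.
  rewrite -ge0_integralZl//; last exact: measurable_funTS.
  by apply: eq_integral => w /set_mem /= ->; rewrite EFinM.
rewrite integral_gsize_add// muleCA -ge0_integralZl//; last first.
  exact: measurable_funTS.
by congr (_ * _)%E; apply: eq_integral => w /set_mem /= ->; rewrite -EFinM.
Qed.

(** * Mean, variance and covariance of generation sizes *)

Lemma expectation_gen_size n :
  ('E_P[gen_size X n] = (\prod_(0 <= i < n) mu i)%:E)%E.
Proof. by rewrite unlock integral_gsize. Qed.

(** This form is free of division: it covers zero means, and [k = 0] gives the variance. *)
Lemma covariance_gen_size n k :
  covariance P (gen_size X n) (gen_size X (n + k)) =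
  ((\prod_(n <= i < n + k) mu i) * gsize_var n)%:E.
Proof.
have L1 (Y : T -> R) (y : R) : measurable_fun setT (fun w => (Y w)%:E) ->
    (forall w, 0 <= Y w) -> (\int[P]_w (Y w)%:E = y%:E)%E -> Y \in Lfun P 1.
  move=> mY Y0 Yy; apply/Lfun1_integrable/integrableP; split=> //.
  under eq_integral => w _ do rewrite /= ger0_norm//.
  by rewrite Yy ltry.
have m1 l : measurable_fun setT (fun w => (gen_size X l w)%:E).
  exact: (measurable_gsize_comp l (fun k => k%:R)).
rewrite covarianceE.
- rewrite !expectation_gen_size unlock integral_gsizeM -EFinM -EFinB; congr EFin.
  by rewrite (big_cat_nat (n := n) (leq0n _) (leq_addr k n))/=; ring.
- by apply: (L1 _ _ (m1 n)) (integral_gsize n) => w; exact: ler0n.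
- by apply: (L1 _ _ (m1 (n + k)%N)) (integral_gsize (n + k)) => w; exact: ler0n.
- apply: L1 (integral_gsizeM n k) => [|w]; last by rewrite mulr_ge0// ler0n.
  by under eq_fun do rewrite EFinM; exact: emeasurable_funM (m1 n) (m1 (n + k)%N).
Qed.

Definition gsize_mean n : R := \prod_(0 <= i < n) mu i.

Lemma gsize_mean_ge0 n : 0 <= gsize_mean n.
Proof. by rewrite prodr_ge0// => i _; exact: mu_ge0. Qed.

Lemma gsize_meanD n k :
  gsize_mean (n + k) = gsize_mean n * \prod_(n <= i < n + k) mu i.
Proof. by rewrite /gsize_mean (big_cat_nat (n := n) (leq0n _) (leq_addr k n)). Qed.

(* The junk value 0 of the division for [gsize_mean n = 0] is the right one. *)
Lemma covariance_gen_sizeE n k :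
  covariance P (gen_size X n) (gen_size X (n + k)) =
  (gsize_var n / gsize_mean n * gsize_mean (n + k))%:E.
Proof.
rewrite covariance_gen_size gsize_meanD; congr EFin.
have [M0|M0] := eqVneq (gsize_mean n) 0.
  by rewrite gsize_var_eq0// mulr0 !mul0r.
by rewrite mulrA divfK// mulrC.
Qed.

(** Passes from division in [\bar R] to division in [R]. For mean 0 both sides are 0 because of the
    numerator, whatever the inverse of 0 is. *)
Lemma gsize_var_div n (x : \bar R) :
  ((gsize_var n)%:E * (x / (gsize_mean n)%:E) =
   (gsize_var n / gsize_mean n)%:E * x)%E.
Proof.
have [M0|M0] := eqVneq (gsize_mean n) 0.
  by rewrite gsize_var_eq0// mul0r !mul0e.
by rewrite inver (negPf M0) EFinM muleA muleAC.
Qed.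

(** * Mean and variance of the total size *)

Lemma tree_sizeE w : tree_size X w = (\sum_(n <oo) (gsize n w)%:R%:E)%E.
Proof. exact: counting_vertices. Qed.

Lemma measurable_tree_size : measurable_fun setT (tree_size X).
Proof.
rewrite (_ : tree_size X = fun w => \sum_(n <oo) (gsize n w)%:R%:E)%E; last first.
  by apply/funext => w; exact: tree_sizeE.
apply: ge0_emeasurable_sum => n //.
by move=> _; exact: (measurable_gsize_comp n (fun k => k%:R)).
Qed.

Lemma emean_tree_size :
  emean P (tree_size X) = (\sum_(n <oo) (gsize_mean n)%:E)%E.
Proof.
rewrite /emean; under eq_integral do rewrite tree_sizeE.
rewrite integral_nneseries//.
  by apply: eq_eseriesr => n _; exact: integral_gsize.
by move=> n; exact: (measurable_gsize_comp n (fun k => k%:R)).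
Qed.

(** Covariance plus product of means: the first part will sum to the asserted series, the second to
    the square of the mean. *)
Lemma integral_gsizeM_mean n k :
  (\int[P]_w ((gsize n w)%:R%:E * (gsize (n + k) w)%:R%:E) =
   (gsize_var n / gsize_mean n * gsize_mean (n + k))%:E
     + (gsize_mean n)%:E * (gsize_mean (n + k))%:E)%E.
Proof.
under eq_integral do rewrite -EFinM.
rewrite integral_gsizeM -covariance_gen_sizeE covariance_gen_size.
by rewrite gsize_meanD -EFinM -EFinD; congr EFin; rewrite /gsize_mean; ring.
Qed.

Definition var_term n : \bar R := ((gsize_var n)%:E
  + 2%:E * (gsize_var n / gsize_mean n)%:E
    * \sum_(1 <= k <oo) (gsize_mean (n + k))%:E)%E.

Lemma integral_tree_size_sqr :
  (\int[P]_w (tree_size X w * tree_size X w) =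
   \sum_(n <oo) var_term n
     + emean P (tree_size X) * emean P (tree_size X))%E.
Proof.
have M0 n : (0 <= (gsize_mean n)%:E)%E by rewrite lee_fin gsize_mean_ge0.
have VM0 n : 0 <= gsize_var n / gsize_mean n.
  by rewrite divr_ge0 ?gsize_var_ge0 ?gsize_mean_ge0.
have m1 l := measurable_gsize_comp l (fun k => k%:R).
have mZZ n k : measurable_fun setT
    (fun w => (gsize n w)%:R%:E * (gsize k w)%:R%:E : \bar R)%E.
  exact: emeasurable_funM.
have ZZ0 n k w : (0 <= (gsize n w)%:R%:E * (gsize k w)%:R%:E :> \bar R)%E.
  by rewrite mule_ge0.
(* Inner sums are shifted to start at 0 before they are exchanged with the integral. *)
have addn1E (h : nat -> \bar R) : (forall k, 0 <= h k)%E ->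
    (\sum_(1 <= k <oo) h k = \sum_(k <oo) h (k + 1)%N)%E.
  by move=> h0; rewrite -nneseries_addn.
rewrite emean_tree_size nneseries_sqr// -nneseriesD; last 2 first.
- by move=> n _ _; rewrite adde_ge0 ?lee_fin ?gsize_var_ge0// mule_ge0//;
    [rewrite mule_ge0// lee_fin|exact: nneseries_ge0].
- move=> n _ _; rewrite adde_ge0 ?mule_ge0//.
  exact: nneseries_ge0.
under eq_integral do rewrite tree_sizeE nneseries_sqr//.
have tE n w : (2%:E * (gsize n w)%:R%:E
      * \sum_(1 <= k <oo) (gsize (n + k) w)%:R%:E =
    2%:E * \sum_(k <oo) ((gsize n w)%:R%:E * (gsize (n + (k + 1)) w)%:R%:E)
      :> \bar R)%E.
  by rewrite -muleA nneseriesZl// addn1E.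
have mt n : measurable_fun setT (fun w =>
    \sum_(k <oo) ((gsize n w)%:R%:E * (gsize (n + (k + 1)) w)%:R%:E)
    : \bar R)%E.
  by apply: ge0_emeasurable_sum => k.
have t0 n w : (0 <= \sum_(k <oo) ((gsize n w)%:R%:E
    * (gsize (n + (k + 1)) w)%:R%:E) :> \bar R)%E by exact: nneseries_ge0.
under eq_integral do under eq_eseriesr do rewrite tE.
rewrite integral_nneseries//; last 2 first.
- by move=> n; apply: emeasurable_funD => //; exact: measurable_funeM.
- by move=> n w _; rewrite adde_ge0// mule_ge0.
apply: eq_eseriesr => n _.
rewrite ge0_integralD//; last 2 first.
- by move=> w _; rewrite mule_ge0.
- exact: measurable_funeM.
rewrite ge0_integralZl// integral_nneseries//.
under eq_eseriesr do rewrite integral_gsizeM_mean.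
have := integral_gsizeM_mean n 0; rewrite addn0 => ->.
rewrite nneseriesD; do ?[by move=> k _ _;
  rewrite ?mule_ge0// lee_fin mulr_ge0// ?gsize_mean_ge0].
under eq_eseriesr do rewrite EFinM.
rewrite !nneseriesZl//.
rewrite ge0_muleDr ?mule_ge0 ?nneseries_ge0 ?lee_fin ?gsize_mean_ge0//.
rewrite /var_term !addn1E// !muleA addeACA; congr (_ + _ + _)%E.
(* In the diagonal term, dividing and multiplying by the mean gives back the variance, also for mean
   0, where the variance is 0. *)
have [m0|m0] := eqVneq (gsize_mean n) 0.
  by rewrite m0 mulr0 gsize_var_eq0.
by rewrite divfK.
Qed.

(** With [S] the total size and [m] its mean, integrate [(S - m)^2 + 2 m S = S^2 + m^2]. All terms
    are nonnegative, and only the finite constant [2 m^2] is cancelled. *)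
Lemma evariance_tree_size_fin : (emean P (tree_size X) < +oo)%E ->
  evariance P (tree_size X) = (\sum_(n <oo) var_term n)%E.
Proof.
move=> mfin; have S0 w : (0 <= tree_size X w)%E.
  by rewrite tree_sizeE; exact: nneseries_ge0.
have mS := measurable_tree_size.
have := integral_tree_size_sqr; rewrite /evariance.
have mE : emean P (tree_size X) = (\int[P]_w tree_size X w)%E by [].
have : (0 <= emean P (tree_size X))%E by apply: integral_ge0 => w _; exact: S0.
case: (emean P (tree_size X)) mE mfin => [m| |] // mE _; rewrite lee_fin => m0.
have sqE w : ((tree_size X w - m%:E) ^+ 2 + (m *+ 2)%:E * tree_size X w =
    tree_size X w * tree_size X w + m%:E * m%:E)%E.
  move: (S0 w); case: (tree_size X w) => [s| |] // s0.
    by rewrite -EFinB -EFin_expe -!EFinM -!EFinD; congr EFin; rewrite mulr2n; ring.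
  (* At total size +oo both sides are +oo; the mixed term is +oo if [m > 0] and 0 if [m = 0]. *)
  rewrite addye// ?expe2 ?mulyy ?addye//.
  by case: ltgtP m0 => // [m0|<-] _; rewrite ?mul0rn ?mul0e// gt0_muley// lte_fin
    mulrn_wgt0.
have msq : measurable_fun setT (fun w => (tree_size X w - m%:E) ^+ 2)%E.
  by under eq_fun do rewrite expe2; apply: emeasurable_funM;
    apply: emeasurable_funB.
have m20 : (0 <= (m *+ 2)%:E)%E by rewrite lee_fin mulrn_wge0.
have mm0 : (0 <= m%:E * m%:E)%E by rewrite mule_ge0.
have lhs : (\int[P]_w ((tree_size X w - m%:E) ^+ 2 + (m *+ 2)%:E * tree_size X w)
    = \int[P]_w (tree_size X w - m%:E) ^+ 2 + (m%:E * m%:E + m%:E * m%:E))%E.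
  rewrite ge0_integralD//; first last.
  - exact: measurable_funeM.
  - by move=> w _; rewrite mule_ge0.
  - by move=> w _; exact: sqre_ge0.
  rewrite ge0_integralZl// -mE -!EFinM -EFinD; congr (_ + _%:E)%E.
  by rewrite mulr2n mulrDl.
have rhs : (\int[P]_w (tree_size X w * tree_size X w + m%:E * m%:E)
    = \int[P]_w (tree_size X w * tree_size X w) + m%:E * m%:E)%E.
  rewrite ge0_integralD//; first last.
  - exact: emeasurable_funM.
  - by move=> w _; rewrite mule_ge0.
  congr (_ + _)%E; transitivity (\int[P]_w cst (m%:E * m%:E) w)%E; first by [].
  by rewrite integral_cst// -[RHS]mule1; congr (_ * _)%E; exact: probability_setT.
have fin2 : (m%:E * m%:E + m%:E * m%:E)%E \is a fin_num by [].
move=> SS; rewrite -[LHS](addeK _ fin2) -lhs.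
under eq_integral do rewrite sqE.
by rewrite rhs SS -(addeA _ (m%:E * m%:E)%E (m%:E * m%:E)%E) addeK.
Qed.

Lemma evariance_tree_size_infty : emean P (tree_size X) = +oo%E ->
  evariance P (tree_size X) = +oo%E.
Proof.
move=> moo; rewrite /evariance moo.
transitivity (\int[P]_w cst +oo w)%E.
  by apply: eq_integral => w _; rewrite expe2 /= addeNy mulNyNy.
rewrite integral_cst// -[RHS](mule1 +oo%E); congr (_ * _)%E.
exact: probability_setT.
Qed.

(** A nonzero [sigma i] gives generation [i.+1] a positive variance, and its covariances with later
    generations are a positive multiple of means whose sum diverges. *)
Lemma var_term_infty i : sigma i != 0 -> emean P (tree_size X) = +oo%E ->
  var_term i.+1 = +oo%E.
Proof.
move=> si moo.
have M0 n : (0 <= (gsize_mean n)%:E)%E by rewrite lee_fin gsize_mean_ge0.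
(* Partial sums of the means are finite, so every tail is infinite; in particular no mean is 0, as
   all later ones would be 0 too. *)
have tail n : (\sum_(n <= k <oo) (gsize_mean k)%:E = +oo)%E.
  move: moo; rewrite emean_tree_size (nneseries_split 0 n)// add0n sumEFin.
  by case: (\sum_(n <= k <oo) _)%E.
have Mn0 n : 0 < gsize_mean n.
  rewrite lt0r gsize_mean_ge0 andbT; apply/negP => /eqP Mn.
  suff : (\sum_(n <= k <oo) (gsize_mean k)%:E = 0)%E by rewrite tail.
  apply: eseries0 => k nk _; congr EFin.
  by rewrite -(subnKC nk) gsize_meanD Mn mul0r.
have V0 : 0 < gsize_var i.+1.
  rewrite gsize_varS ltr_pwDl ?(mulr_ge0 (sqr_ge0 _) (gsize_var_ge0 _))//.
  by rewrite mulr_gt0// ?Mn0// exprn_even_gt0.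
have tE : (\sum_(1 <= k <oo) (gsize_mean (i.+1 + k))%:E =
    \sum_(i.+2 <= k <oo) (gsize_mean k)%:E)%E.
  rewrite -(@nneseries_addn _ (fun k => (gsize_mean (i.+1 + k))%:E) 1)//.
  rewrite -(@nneseries_addn _ (fun k => (gsize_mean k)%:E) i.+2)//.
  by apply: eq_eseriesr => k _; rewrite addnCA addn1.
rewrite /var_term tE tail gt0_muley ?addey// -EFinM lte_fin mulr_gt0//.
exact: divr_gt0.
Qed.

Lemma var_term_ge0 n : (0 <= var_term n)%E.
Proof.
rewrite adde_ge0 ?lee_fin ?gsize_var_ge0// mule_ge0//.
  by rewrite mule_ge0// lee_fin divr_ge0 ?gsize_var_ge0 ?gsize_mean_ge0.
by apply: nneseries_ge0 => k _ _; rewrite lee_fin gsize_mean_ge0.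
Qed.

Lemma sum_var_term : (\sum_(n <oo) var_term n = \sum_(1 <= n <oo) var_term n)%E.
Proof.
have v0 := var_term_ge0.
rewrite nneseries_recl// [X in (X + _)%E](_ : _ = 0%E) ?add0e//.
rewrite /var_term (_ : gsize_var 0 = 0); last by rewrite /gsize_var big_geq.
by rewrite mul0r mule0 mul0e adde0.
Qed.

End moments.

End independence.

(* In the formula for the variance of the total size, the hypothesis only
   excludes the case of a deterministic infinite tree, where the series is 0
   and the variance has no meaning. *)
Theorem proposition2p1 (d : measure_display) (T : measurableType d)
    (R : realType) (P : probability T R)
    (f : nat -> nat -> R) (mu sigma : nat -> R)
    (hf : forall n, is_pmf (f n))
    (hmom : forall n, has_mean_variance (f n) (mu n) (sigma n ^+ 2))
    (X : nat -> nat -> {RV P >-> nat})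
    (hX : is_offspring_family f X) :
  let Z : nat -> T -> R := gen_size X in
  let m_ (n : nat) : \bar R := ('E_P[Z n])%E in
  let s2_ (n : nat) : \bar R := 'V_P[Z n] in
  let c_ (n l : nat) : \bar R := covariance P (Z n) (Z l) in
  let m : \bar R := emean P (tree_size X) in
  let s2 : \bar R := evariance P (tree_size X) in
  [/\ forall n : nat, m_ n = (\prod_(0 <= i < n) mu i)%:E,
      forall n : nat,
        s2_ n = (\sum_(0 <= i < n) sigma i ^+ 2 * (\prod_(0 <= j < i) mu j)
                   * (\prod_(i.+1 <= j < n) mu j ^+ 2))%:E,
      forall n k : nat, (0 < k)%N ->
        (c_ n (n + k)%N = s2_ n * (m_ (n + k)%N / m_ n))%E,
      (m = \sum_(0 <= n <oo) (\prod_(0 <= i < n) mu i)%R%:E)%E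
    & (m < +oo)%E \/ (exists i, sigma i != 0) ->
      (s2 = \sum_(1 <= n <oo)
              (s2_ n + 2%:E * (s2_ n / m_ n)
                       * \sum_(1 <= k <oo) m_ (n + k)%N))%E].
Proof.
move=> Z m_ s2_ c_ m s2.
have mE n : m_ n = (gsize_mean mu n)%:E.
  exact: (expectation_gen_size hX hf hmom).
have cE := covariance_gen_sizeE hX hf hmom.
(* The variance is the covariance of a variable with itself, hence the case [k = 0]. *)
have sE n : s2_ n = (gsize_var mu sigma n)%:E.
  have := covariance_gen_size hX hf hmom n 0.
  by rewrite addn0 big_geq// mul1r.
have ESE := emean_tree_size hX hf hmom.
split=> //.
- by move=> n k _; rewrite /c_ cE sE !mE (gsize_var_div hf hmom) EFinM.
- move=> h.
  rewrite [RHS](_ : _ = \sum_(1 <= n <oo) var_term mu sigma n)%E; last first.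
    apply: eq_eseriesr => n _; rewrite /var_term sE mE; congr (_ + _ * _)%E.
      congr (_ * _)%E; have := gsize_var_div hf hmom n 1%E.
      by rewrite mule1 mul1e.
    by apply: eq_eseriesr => k _; rewrite mE.
  rewrite -(sum_var_term hf hmom).
  have [mfin|] := boolP (m < +oo)%E.
    exact: (evariance_tree_size_fin hX hf hmom mfin).
  rewrite -leNgt leye_eq => /eqP moo.
  (* For an infinite mean only the second alternative remains; its term [i.+1] is infinite, so the
     series is +oo, as is the variance. *)
  case: h => [|[i si]]; first by rewrite moo ltxx.
  rewrite (nneseries_pinfty (k := i.+1))//.
  + exact: evariance_tree_size_infty.
  + by move=> n _; exact: (var_term_ge0 hf hmom).
  + exact: (var_term_infty hX hf hmom si moo).
Qed.
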